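(* For every sequence $\alpha=(\alpha_n)_{n\in\mathbb{N}}$ with $\alpha_n\uparrow\infty$, $$\sigma(\mathsf{C};\Lambda_0(\alpha))\subseteq\left\{\lambda\in\mathbb{C}\colon\left|\lambda-\tfrac12\right|\leq\tfrac12\right\}.$$
   Context: Notation: $\mathbb{N}=\{1,2,3,\ldots\}$. The notation $\alpha_n\uparrow\infty$ means that $\alpha=(\alpha_n)_{n\in\mathbb{N}}\subseteq(1,\infty)$ satisfies $\alpha_n<\alpha_{n+1}$ for all $n\in\mathbb{N}$ and $\lim_{n\to\infty}\alpha_n=\infty$. For $k,n\in\mathbb{N}$ put $w_k(n):=e^{-\alpha_n/k}$. The power series space of finite type is $\Lambda_0(\alpha):=\{x\in\mathbb{C}^{\mathbb{N}}\colon \lim_{n\to\infty}w_k(n)|x_n|=0 \text{ for all } k\in\mathbb{N}\}$, a Fréchet space for the topology generated by the increasing sequence of norms $p_k(x):=\sup_{n\in\mathbb{N}}w_k(n)|x_n|$, $k\in\mathbb{N}$. The discrete Cesàro operator is $\mathsf{C}x:=\left(x_1,\frac{x_1+x_2}{2},\ldots,\frac{x_1+\cdots+x_n}{n},\ldots\right)$ for $x\in\mathbb{C}^{\mathbb{N}}$; it maps $\Lambda_0(\alpha)$ continuously into itself. For a locally convex Hausdorff space $X$, $\mathcal{L}(X)$ is the space of continuous linear operators from $X$ into itself; for $T\in\mathcal{L}(X)$ the resolvent set $\rho(T;X)$ consists of all $\lambda\in\mathbb{C}$ such that $(\lambda I-T)^{-1}$ exists in $\mathcal{L}(X)$, and the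 spectrum is $\sigma(T;X):=\mathbb{C}\setminus\rho(T;X)$. *)

(* Defs.v *)
From HB Require Import structures.
From mathcomp Require Import all_boot all_order all_algebra.
From mathcomp Require Import all_classical all_reals all_analysis.
From mathcomp Require Import complex.

Set Implicit Arguments.
Unset Strict Implicit.
Unset Printing Implicit Defensive.

Import Order.TTheory GRing.Theory Num.Theory.
Import numFieldNormedType.Exports.
Import ComplexField.Normc.

Local Open Scope classical_set_scope.
Local Open Scope ring_scope.

Record continuous_endo (K : numFieldType) (X : tvsType K) := ContinuousEndo {
  endo_linear :> {linear X -> X};
  endo_continuous : continuous endo_linear }.

Definition resolvent_set (K : numFieldType) (X : tvsType K)
    (T : continuous_endo X) : set K :=
  [set l | exists S : continuous_endo X,
     cancel (fun x => l *: x - T x) S /\ cancel S (fun x => l *: x - T x)].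

Definition spectrum (K : numFieldType) (X : tvsType K)
    (T : continuous_endo X) : set K := ~` resolvent_set T.

(* Sequences are indexed from 0 : [alpha n], [x n] and [weight alpha k n] are
   the usual alpha_(n+1), x_(n+1) and w_(k+1)(n+1) of indices starting at 1. *)
Definition increases_to_infty (R : realType) (alpha : nat -> R) : Prop :=
  [/\ forall n, 1 < alpha n,
      forall n, alpha n < alpha n.+1
    & alpha n @[n --> \oo] --> +oo].

Definition weight (R : realType) (alpha : nat -> R) (k n : nat) : R :=
  expR (- (alpha n / k.+1%:R)).

Definition lambda0_pred (R : realType) (alpha : nat -> R) :
    {pred nat -> R[i]} :=
  mem [set x : nat -> R[i] |
       forall k, weight alpha k n * normc (x n) @[n --> \oo] --> (0 : R)].

Record lambda0 (R : realType) (alpha : nat -> R) := Lambda0 {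
  lambda0_val :> nat -> R[i];
  _ : lambda0_val \in lambda0_pred alpha }.

Definition lambda0_norm (R : realType) (alpha : nat -> R) (k : nat)
    (x : lambda0 alpha) : R :=
  sup [set weight alpha k n * normc (x n) | n in [set: nat]].

Section lambda0_lmodule.
Variables (R : realType) (alpha : nat -> R).

HB.instance Definition _ := [isSub for @lambda0_val R alpha].
HB.instance Definition _ := [Choice of lambda0 alpha by <:].

Lemma normcr0 : normc (0 : R[i]) = 0.
Proof. exact: normc0. Qed.

Lemma weight_gt0 k n : 0 < weight alpha k n.
Proof. exact: expR_gt0. Qed.

Lemma normc_ge0 (z : R[i]) : 0 <= normc z.
Proof. by case: z => a b /=; exact: sqrtr_ge0. Qed.

Lemma weightM_ge0 k n (z : R[i]) : 0 <= weight alpha k n * normc z.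
Proof. by rewrite mulr_ge0// ?normc_ge0// ltW// weight_gt0. Qed.

Lemma lambda0_predP (x : nat -> R[i]) : x \in lambda0_pred alpha <->
  forall k, weight alpha k n * normc (x n) @[n --> \oo] --> (0 : R).
Proof. by rewrite /lambda0_pred /= inE. Qed.

Lemma lambda0_submod_closed : submod_closed (lambda0_pred alpha).
Proof.
split.
  apply/lambda0_predP => k.
  suff -> : (fun n => weight alpha k n * normc ((0 : nat -> R[i]) n)) = cst 0.
    exact: cvg_cst.
  by apply/funext => n; rewrite -[RHS](mulr0 (weight alpha k n)) -normcr0.
move=> a x y /lambda0_predP xP /lambda0_predP yP; apply/lambda0_predP => k.
have lim0 : normc a * (weight alpha k n * normc (x n)) +
    weight alpha k n * normc (y n) @[n --> \oo] --> (0 : R).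
  rewrite -[X in _ --> X](addr0 (0 : R)) -[X in _ --> X + _](mulr0 (normc a)).
  by apply: cvgD => //; apply: cvgM => //; exact: cvg_cst.
apply: (squeeze_cvgr _ (cvg_cst (0 : R)) lim0).
apply: nearW => n; rewrite weightM_ge0 /= mulrCA -mulrDr -normcM.
by rewrite ler_wpM2l ?le_normcD// ltW// weight_gt0.
Qed.

HB.instance Definition _ := GRing.isSubmodClosed.Build _ _ (lambda0_pred alpha)
  lambda0_submod_closed.
HB.instance Definition _ := [SubChoice_isSubLmodule of lambda0 alpha by <:].

End lambda0_lmodule.

Section lambda0_topology.
Variables (R : realType) (alpha : nat -> R).
Local Notation X := (lambda0 alpha).
Local Notation p := (@lambda0_norm R alpha).
Implicit Types (x y z : X) (k n : nat).

Lemma lambda0P x k : weight alpha k n * normc (x n) @[n --> \oo] --> (0 : R).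
Proof. by have /lambda0_predP := valP x; apply. Qed.

Lemma lambda0_has_sup x k :
  has_sup [set weight alpha k n * normc (x n) | n in [set: nat]].
Proof.
split; first by exists (weight alpha k 0%N * normc (x 0%N)); exists 0%N.
have /cvgP/cvg_seq_bounded[M [Mr MP]] := @lambda0P x k.
exists (M + 1) => _ [n _ <-].
apply: le_trans (ler_norm _) _.
by apply: MP; rewrite ?ltrDl.
Qed.

Lemma lambda0_norm_ub x k n : weight alpha k n * normc (x n) <= p k x.
Proof. by apply: ub_le_sup; [case: (lambda0_has_sup x k)|exists n]. Qed.

Lemma lambda0_norm_le x k (c : R) :
  (forall n, weight alpha k n * normc (x n) <= c) -> p k x <= c.
Proof.
move=> h; apply: ge_sup; first by case: (lambda0_has_sup x k).
by move=> _ [n _ <-].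
Qed.

Lemma lambda0_norm_ge0 x k : 0 <= p k x.
Proof. exact: le_trans (weightM_ge0 _ _ _ _) (lambda0_norm_ub x k 0%N). Qed.

Lemma lambda0_normD x y k : p k (x + y) <= p k x + p k y.
Proof.
apply: lambda0_norm_le => n.
apply: le_trans (lerD (lambda0_norm_ub x k n) (lambda0_norm_ub y k n)).
by rewrite -mulrDr ler_wpM2l ?le_normcD// ltW// weight_gt0.
Qed.

Lemma lambda0_normZ_le (a : R[i]) x k : p k (a *: x) <= normc a * p k x.
Proof.
apply: lambda0_norm_le => n; rewrite /= normcM mulrCA.
by rewrite ler_wpM2l ?normc_ge0// lambda0_norm_ub.
Qed.

Lemma lambda0_norm0 k : p k 0 = 0.
Proof.
apply/eqP; rewrite eq_le lambda0_norm_ge0 andbT.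
by apply: lambda0_norm_le => n; rewrite -(mulr0 (weight alpha k n)) -normcr0.
Qed.

Lemma lambda0_normN x k : p k (- x) = p k x.
Proof.
suff h y : p k (- y) <= p k y.
  by apply/eqP; rewrite eq_le h -{1}(opprK x) h.
by apply: lambda0_norm_le => n; rewrite /= normcN lambda0_norm_ub.
Qed.

Lemma lambda0_norm_eq0 x k : p k x = 0 -> x = 0.
Proof.
move=> px0; apply/val_inj/funext => n /=; apply: eq0_normc; apply/eqP.
have : weight alpha k n * normc (x n) <= 0 by rewrite -px0 lambda0_norm_ub.
rewrite pmulr_rle0 ?weight_gt0// => h.
by rewrite eq_le h normc_ge0.
Qed.

Definition lambda0_ball x k (e : R) : set X :=
  [set y | forall j, (j <= k)%N -> p j (y - x) < e].

Lemma lambda0_ball_center x k (e : R) : 0 < e -> lambda0_ball x k e x.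
Proof. by move=> e0 j _; rewrite subrr lambda0_norm0. Qed.

(* Finite intersections of balls of the norms form a neighbourhood base. *)
Definition lambda0_nbhs x : set_system X :=
  [set A | exists k, exists2 e : R, 0 < e & lambda0_ball x k e `<=` A].

Lemma lambda0_ball_sub x y k (e : R) : lambda0_ball x k e y ->
  exists2 d : R, 0 < d & lambda0_ball y k d `<=` lambda0_ball x k e.
Proof.
move=> xy.
have [d d0 dP] : exists2 d : R, 0 < d &
    forall j, (j <= k)%N -> p j (y - x) + d <= e.
  elim: k xy => [|k IH] xy.
    exists (e - p 0%N (y - x)); first by rewrite subr_gt0 xy.
    by move=> j; rewrite leqn0 => /eqP ->; rewrite addrC subrK.
  have [|d d0 dP] := IH; first by move=> j jk; apply: xy; exact: leqW.
  exists (Num.min d (e - p k.+1 (y - x))).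
    by rewrite lt_min d0 subr_gt0 xy.
  move=> j; rewrite leq_eqVlt => /orP[/eqP ->|].
    by rewrite -lerBrDl ge_min lexx orbT.
  rewrite ltnS => /dP; apply: le_trans.
  by rewrite lerD2l ge_min lexx.
exists d => // z yz j jk; rewrite -(subrK y z) -addrA.
apply: le_lt_trans (lambda0_normD _ _ _) _.
by apply: lt_le_trans (dP j jk); rewrite [ltLHS]addrC ltrD2l yz.
Qed.

HB.instance Definition _ := hasNbhs.Build X lambda0_nbhs.

Lemma lambda0_nbhs_filter x : ProperFilter (nbhs x).
Proof.
split.
  by move=> [k [e e0 /(_ x)]]; apply; exact: lambda0_ball_center.
split.
- by exists 0%N, 1.
- move=> A B [k [e e0 eA]] [l [d d0 dB]].
  exists (maxn k l), (Num.min e d); first by rewrite lt_min e0.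
  move=> y xy; split.
    apply: eA => j jk.
    have := xy j; rewrite lt_min => /(_ _)/andP[]//.
    exact: leq_trans jk (leq_maxl _ _).
  apply: dB => j jl.
  have := xy j; rewrite lt_min => /(_ _)/andP[]//.
  exact: leq_trans jl (leq_maxr _ _).
- by move=> A B AB [k [e e0 eA]]; exists k, e => //; exact: subset_trans AB.
Qed.

Lemma lambda0_nbhs_singleton x (A : set X) : nbhs x A -> A x.
Proof. by move=> [k [e e0]]; apply; exact: lambda0_ball_center. Qed.

Lemma lambda0_nbhs_nbhs x (A : set X) : nbhs x A -> nbhs x (nbhs^~ A).
Proof.
move=> [k [e e0 eA]]; exists k, e => // y /lambda0_ball_sub[d d0 dP].
by exists k, d => //; exact: subset_trans eA.
Qed.

HB.instance Definition _ := Nbhs_isNbhsTopological.Build X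
  lambda0_nbhs_filter lambda0_nbhs_singleton lambda0_nbhs_nbhs.

Lemma lambda0_nbhsE x (A : set X) : nbhs x A <->
  exists k, exists2 e : R, 0 < e & lambda0_ball x k e `<=` A.
Proof. by []. Qed.

Lemma lambda0_ball_nbhs x k (e : R) : 0 < e -> nbhs x (lambda0_ball x k e).
Proof. by move=> e0; exists k, e. Qed.

Lemma lambda0_ball_open x k (e : R) : open (lambda0_ball x k e).
Proof.
rewrite openE => y /lambda0_ball_sub[d d0 dP].
by exists k, d.
Qed.

Lemma lambda0_add_continuous : continuous (fun xy : X * X => xy.1 + xy.2).
Proof.
move=> [x y] /= A [k [e e0 eA]].
have e20 : 0 < e / 2 by rewrite divr_gt0.
exists (lambda0_ball x k (e / 2), lambda0_ball y k (e / 2)) => /=.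
  by split; exact: lambda0_ball_nbhs.
move=> [x' y'] /= [xx' yy']; apply: eA => j jk /=.
rewrite opprD addrACA (splitr e).
by apply: le_lt_trans (lambda0_normD _ _ _) _; rewrite ltrD// ?xx'// yy'.
Qed.

Lemma lambda0_norm_bounded x k :
  exists2 M : R, 0 < M & forall j, (j <= k)%N -> p j x <= M.
Proof.
exists (1 + \sum_(j < k.+1) p j x).
  by rewrite ltr_pwDl// sumr_ge0// => j _; exact: lambda0_norm_ge0.
move=> j jk; rewrite (bigD1 (Ordinal (n:=k.+1) (m:=j) jk))//= addrCA lerDl.
by rewrite addr_ge0// sumr_ge0// => i _; exact: lambda0_norm_ge0.
Qed.

Lemma lambda0_scale_continuous :
  continuous (fun ax : (R[i])^o * X => ax.1 *: ax.2).
Proof.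
move=> [a x] /= A [k [e e0 eA]].
have [M M0 xM] := lambda0_norm_bounded x k.
pose N := normc a + 1.
have N0 : 0 < N by rewrite ltr_wpDl// normc_ge0.
pose d := Num.min 1 (e / 2 / M).
have d0 : 0 < d by rewrite lt_min ltr01 !divr_gt0.
exists (ball (a : (R[i])^o) d%:C%C, lambda0_ball x k (e / 2 / N)) => /=.
  split; first by apply: nbhsx_ballx; rewrite ltcR.
  by apply: lambda0_ball_nbhs; rewrite !divr_gt0.
move=> [b y] /= [ab xy]; apply: eA => j jk /=.
have {}ab : normc (b - a) < d.
  by move: ab; rewrite -ball_normE /= distrC normc_def -ltcR; case: (b - a).
have bN : normc b <= N.
  rewrite -(subrK a b) addrC; apply: le_trans (le_normcD _ _) _.
  by rewrite lerD2l ltW// (lt_le_trans ab)// ge_min lexx.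
have -> : b *: y - a *: x = b *: (y - x) + (b - a) *: x.
  by rewrite scalerBr scalerBl addrA subrK.
apply: le_lt_trans (lambda0_normD _ _ _) _; rewrite (splitr e) ltr_leD//.
  apply: le_lt_trans (lambda0_normZ_le _ _ _) _.
  apply: le_lt_trans (_ : _ <= N * p j (y - x)) _.
    by rewrite ler_wpM2r ?lambda0_norm_ge0.
  by rewrite mulrC -ltr_pdivlMr// xy.
apply: le_trans (lambda0_normZ_le _ _ _) _.
apply: le_trans (_ : _ <= (e / 2 / M) * M) _; last by rewrite divfK ?gt_eqF.
rewrite ler_pM ?normc_ge0 ?lambda0_norm_ge0 ?xM//.
by rewrite ltW// (lt_le_trans ab)// ge_min lexx orbT.
Qed.

Lemma lambda0_ball_convex x k (e : R) :
  convex_set (lambda0_ball x k e : set X).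
Proof.
apply/convex_setW => y z; rewrite !inE => xy xz l l0 l1; rewrite inE => j jk.
have normcE (a : R[i]) : 0 <= a -> normc a = complex.Re a.
  by case: a => a b; rewrite lecE/= => /andP[/eqP -> a0]; rewrite expr0n addr0
    sqrtr_sqr ger0_norm.
have convE : (l%:num *: (y : X) + (1 - l%:num) *: (z : X)) - x =
    l%:num *: ((y : X) - x) + (1 - l%:num) *: ((z : X) - x).
  by rewrite !scalerBr addrACA -opprD -scalerDl subrKC scale1r.
rewrite -[conv _ _ _]/(l%:num *: (y : X) + (1 - l%:num) *: (z : X)) convE.
apply: le_lt_trans (lambda0_normD _ _ _) _.
have /ltW l0' := l0; have /ltW l1' := l1.
have lr : normc (1 - l%:num) = 1 - normc l%:num.
  by rewrite !normcE ?subr_ge0//; case: (l%:num).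
have ngt0 : 0 < normc l%:num.
  rewrite lt_neqAle normc_ge0 andbT eq_sym; apply/eqP => /eq0_normc h.
  by rewrite h ltxx in l0.
have nlt1 : 0 < 1 - normc l%:num.
  rewrite -lr lt_neqAle normc_ge0 andbT eq_sym; apply/eqP => /eq0_normc h.
  by move/eqP: h; rewrite subr_eq0 => /eqP h; rewrite -h ltxx in l1.
rewrite -[e]mul1r -(subrKC (normc l%:num) 1) mulrDl ltrD//.
  apply: le_lt_trans (lambda0_normZ_le _ _ _) _.
  by rewrite ltr_pM2l// xy.
apply: le_lt_trans (lambda0_normZ_le _ _ _) _.
by rewrite lr ltr_pM2l// xz.
Qed.

Lemma lambda0_locally_convex :
  exists2 B : set_system X, (forall b, b \in B -> convex_set b) & basis B.
Proof.
exists [set b | exists x k, exists2 e : R, 0 < e & b = lambda0_ball x k e].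
  move=> b; rewrite inE => -[x [k [e e0 ->]]]; exact: lambda0_ball_convex.
split; first by move=> b [x [k [e e0 ->]]]; exact: lambda0_ball_open.
move=> x A [k [e e0 eA]]; exists (lambda0_ball x k e) => //.
by split; [exists x, k, e|exact: lambda0_ball_center].
Qed.

(* This factory only installs the uniform structure. *)
HB.instance Definition _ := PreTopologicalLmod_isTvs.Build R[i] X
  lambda0_add_continuous lambda0_scale_continuous lambda0_locally_convex.
HB.instance Definition _ := PreTopologicalNmodule_isTopologicalNmodule.Build X
  lambda0_add_continuous.
HB.instance Definition _ := TopologicalNmodule_isTopologicalLmodule.Build R[i] X
  lambda0_scale_continuous.
HB.instance Definition _ := Uniform_isTvs.Build R[i] X lambda0_locally_convex.

Lemma lambda0_hausdorff : hausdorff_space X.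
Proof.
move=> x y xy; apply/eqP; rewrite -subr_eq0; apply/eqP.
apply: (@lambda0_norm_eq0 _ 0%N); apply/eqP; rewrite eq_le lambda0_norm_ge0 andbT.
apply/ler_addgt0Pr => e e0; rewrite add0r.
have e20 : 0 < e / 2 by rewrite divr_gt0.
have [z [/(_ 0%N (leqnn _)) xz /(_ 0%N (leqnn _)) yz]] :=
  xy _ _ (lambda0_ball_nbhs x 0 e20) (lambda0_ball_nbhs y 0 e20).
rewrite -(subrK z x) -addrA; apply: le_trans (lambda0_normD _ _ _) _.
by rewrite (splitr e) lerD ?ltW// -opprB lambda0_normN.
Qed.

End lambda0_topology.

Definition cesaro_seq (R : realType) (x : nat -> R[i]) (n : nat) : R[i] :=
  (\sum_(i < n.+1) x i) / n.+1%:R.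

Section cesaro_operator.
Variables (R : realType) (alpha : nat -> R).
Hypothesis alpha_up : increases_to_infty alpha.
Local Notation X := (lambda0 alpha).
Implicit Types (x y : X) (k n : nat).

Lemma weight_le k m n : (m <= n)%N -> weight alpha k n <= weight alpha k m.
Proof.
move=> mn; rewrite ler_expR lerN2 ler_pM2r ?invr_gt0//.
have [_ /(_ _)/ltW h _] := alpha_up.
by have /nondecreasing_seqP := h; apply.
Qed.

Lemma normc_nat n : normc (n%:R : R[i]) = n%:R.
Proof. by rewrite normcMn normc1. Qed.

Lemma normc_sum (x : nat -> R[i]) n :
  normc (\sum_(i < n) x i) <= \sum_(i < n) normc (x i).
Proof.
elim: n => [|n IH]; first by rewrite !big_ord0 normcr0.
by rewrite !big_ord_recr/=; apply: le_trans (le_normcD _ _) _; rewrite lerD2r.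
Qed.

Lemma cesaro_seq_le (x : nat -> R[i]) k n :
  weight alpha k n * normc (cesaro_seq x n) <=
  arithmetic_mean (fun m => weight alpha k m * normc (x m)) n.
Proof.
rewrite /cesaro_seq /arithmetic_mean /= normcM normcV normc_nat mulrA mulrC.
rewrite ler_wpM2l ?invr_ge0// seriesEord/=.
apply: le_trans (_ : _ <= weight alpha k n * \sum_(i < n.+1) normc (x i)) _.
  by rewrite ler_wpM2l ?normc_sum// ltW// weight_gt0.
rewrite mulr_sumr; apply: ler_sum => i _.
by rewrite ler_wpM2r ?normc_ge0// weight_le// -ltnS.
Qed.

Lemma cesaro_seq_lambda0 x : cesaro_seq x \in lambda0_pred alpha.
Proof.
apply/lambda0_predP => k.
apply: (squeeze_cvgr _ (cvg_cst (0 : R)) (cesaro (@lambda0P _ _ x k))).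
by apply: nearW => n; rewrite weightM_ge0 cesaro_seq_le.
Qed.

Definition cesaro_fun x : X := Lambda0 (cesaro_seq_lambda0 x).

Lemma cesaro_fun_linear : linear cesaro_fun.
Proof.
move=> a x y; apply/val_inj/funext => n.
rewrite -[RHS]/(a * cesaro_seq x n + cesaro_seq y n) /= /cesaro_seq.
by rewrite mulrA -mulrDl mulr_sumr -big_split.
Qed.

HB.instance Definition _ :=
  GRing.isLinear.Build R[i] X X *:%R cesaro_fun cesaro_fun_linear.

Lemma lambda0_norm_cesaro x k :
  lambda0_norm k (cesaro_fun x) <= lambda0_norm k x.
Proof.
apply: lambda0_norm_le => n; apply: le_trans (cesaro_seq_le _ _ _) _.
rewrite /arithmetic_mean /= seriesEord /= mulrC ler_pdivrMr//.
apply: le_trans (_ : _ <= \sum_(i < n.+1) lambda0_norm k x) _.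
  by apply: ler_sum => i _; exact: lambda0_norm_ub.
by rewrite sumr_const card_ord mulr_natr.
Qed.

Lemma cesaro_fun_continuous : continuous cesaro_fun.
Proof.
move=> x A [k [e e0 eA]]; exists k, e => // y xy; apply: eA => j jk.
by rewrite -linearB; apply: le_lt_trans (lambda0_norm_cesaro _ _) (xy j jk).
Qed.

Definition cesaro_op : continuous_endo X :=
  @ContinuousEndo _ X cesaro_fun cesaro_fun_continuous.

End cesaro_operator.

(* Main.v *)
Require Import Defs.
From HB Require Import structures.
From mathcomp Require Import all_boot all_order all_algebra.
From mathcomp Require Import all_classical all_reals all_analysis.
From mathcomp Require Import complex.
From mathcomp Require Import ring lra.

Import Order.TTheory GRing.Theory Num.Theory.
Import numFieldNormedType.Exports.
Import ComplexField.Normc.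

Local Open Scope classical_set_scope.
Local Open Scope ring_scope.

(** Let [l] lie outside the closed disc and put [a = l^-1].  Inversion maps the
complement of the disc into the half-plane [Re a < 1] ([outside_disc]).

Solving [l y - C y = x] for the partial sums [s_n = y_0 + ... + y_(n-1)] gives
the first order recursion
[(n + 1 - a) s_(n+1) = (n + 1) (s_n + a x_n)],
in which [n + 1 - a] never vanishes since [Re a < 1].  So the equation has
exactly one solution for every [x], namely [y_n = a (x_n + s_(n+1) / (n + 1))]
([sum_resolvent_seq], [resolvent_sum_cesaro]).

With [d = 1 - Re a > 0] one has [n + d <= |n + 1 - a|], so the recursion bounds
the mean [|s_(n+1)| / (n + 1)] by the convex combination, with weights
[n / (n + d)] and [d / (n + d)], of the previous mean [|s_n| / n] and
[(|a| / d) |x_n|].  This survives multiplication by any nonincreasing weight, so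
the means, and hence [y], are bounded in each norm by a constant multiple of the
same norm of [x] ([resolvent_sum_bound], [resolvent_seq_bound]).  The
decay of [y] comes for free from these bounds: for each [k] the weights of
indices [k] and [k + 1] have a ratio tending to 0, so boundedness in all norms
already gives membership in the space ([bounded_lambda0]).  The
inverse thus maps the space into itself and is continuous. *)

Lemma Re_le_normc {R : realType} (z : R[i]) : complex.Re z <= normc z.
Proof.
case: z => x y /=; apply: le_trans (ler_norm x) _.
by rewrite -sqrtr_sqr ler_wsqrtr// lerDl sqr_ge0.
Qed.

(** For [l = x + iy], the point lies outside the disc iff [x < x^2 + y^2], and
[Re l^-1 = x / (x^2 + y^2)]. *)
Lemma outside_disc {R : realType} (l : R[i]) : ~ (`|l - 1 / 2| <= 1 / 2) ->
  l != 0 /\ complex.Re l^-1 < 1.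
Proof.
have half : (1 / 2 : R[i]) = (1 / 2 : R)%:C%C.
  by rewrite rmorphM rmorphV ?unitfE//= !rmorph1 rmorph_nat.
rewrite half normc_def lecR; case: l => x y /= h.
have {}h : x < x ^+ 2 + y ^+ 2.
  rewrite ltNge; apply/negP => le; apply: h.
  rewrite -(ler_pXn2r (_ : 0 < 2)%N) ?nnegrE ?sqrtr_ge0 ?sqr_sqrtr
    ?addr_ge0 ?sqr_ge0//; lra.
have n0 : 0 < x ^+ 2 + y ^+ 2.
  have [x0|x0] := leP 0 x; first exact: le_lt_trans x0 h.
  apply: ltr_pwDl; last exact: sqr_ge0.
  by rewrite exprn_even_gt0//= ltr0_neq0.
split; last by rewrite ltr_pdivrMr ?mul1r.
apply/negP => /eqP [x0 y0]; move: n0; rewrite x0 y0; lra.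
Qed.

Lemma normc_natB_ge {R : realType} (a : R[i]) n :
  n%:R + (1 - complex.Re a) <= normc (n.+1%:R - a).
Proof.
apply: (le_trans _ (Re_le_normc _)).
rewrite raddfB /=.
have -> : complex.Re (n.+1%:R : R[i]) = n.+1%:R by rewrite raddfMn.
by rewrite -natr1; lra.
Qed.

Lemma natB_neq0 {R : realType} (a : R[i]) n :
  complex.Re a < 1 -> n.+1%:R - a != 0.
Proof.
move=> a1; apply/eqP => e; have := normc_natB_ge a n.
by rewrite e normcr0; have := ler0n R n; lra.
Qed.

(** The partial sums of the solution [y] of [l y - C y = x], where [a] is the
inverse of [l], obtained by eliminating [y_n = s_(n+1) - s_n] from
[l y_n - s_(n+1) / (n + 1) = x_n]. *)
Fixpoint resolvent_sum {R : realType} (a : R[i]) (x : nat -> R[i]) (n : nat) :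
    R[i] :=
  if n is m.+1
  then m.+1%:R * (resolvent_sum a x m + a * x m) / (m.+1%:R - a)
  else 0.

Definition resolvent_seq {R : realType} (a : R[i]) (x : nat -> R[i]) (n : nat) :
    R[i] :=
  a * (x n + resolvent_sum a x n.+1 / n.+1%:R).

(** Existence of a solution: the Cesaro means of [resolvent_seq a x] are the
terms [s_(n+1) / (n + 1)] used to define it. *)
Lemma sum_resolvent_seq {R : realType} (a : R[i]) (x : nat -> R[i]) n :
  complex.Re a < 1 -> \sum_(i < n) resolvent_seq a x i = resolvent_sum a x n.
Proof.
move=> a1; elim: n => [|n IH]; first by rewrite big_ord0.
rewrite big_ord_recr /= IH /resolvent_seq /=.
have := natB_neq0 a n a1; have : (n.+1%:R : R[i]) != 0 by rewrite pnatr_eq0.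
move: (resolvent_sum a x n) (x n) (n.+1%:R) => s t N h1 h2.
by field; rewrite h2 h1.
Qed.

(** Uniqueness of the solution: a sequence is determined by its image under
[l - C], because the recursion recovers its partial sums. *)
Lemma resolvent_sum_cesaro {R : realType} (l : R[i]) (y : nat -> R[i]) n :
  l != 0 -> complex.Re l^-1 < 1 ->
  resolvent_sum l^-1 (fun n => l * y n - cesaro_seq y n) n = \sum_(i < n) y i.
Proof.
move=> l0 a1; elim: n => [|n IH]; first by rewrite big_ord0.
rewrite /= IH big_ord_recr /= /cesaro_seq big_ord_recr /=.
have := natB_neq0 _ n a1; have : (n.+1%:R : R[i]) != 0 by rewrite pnatr_eq0.
move: (\sum_(i < n) y i) (y n) (n.+1%:R) => s t N h1 h2.
have h3 : N * l - 1 != 0.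
  by rewrite -[1](mulVf l0) -mulrBl mulf_neq0.
by field; rewrite l0 h1 h3.
Qed.

(** By induction on [w n |s_n| <= n L], where [L = (|a| / d) M] and
[d = 1 - Re a]: the recursion turns this into
[w n |s_(n+1)| <= (n + 1) (n L + d L) / (n + d) = (n + 1) L], and replacing
[w n] by [w (n + 1)] only decreases the left-hand side. *)
Lemma resolvent_sum_bound {R : realType} (a : R[i]) (x : nat -> R[i])
    (w : nat -> R) (M : R) :
  complex.Re a < 1 ->
  (forall n, 0 <= w n) -> (forall n, w n.+1 <= w n) ->
  (forall n, w n * normc (x n) <= M) ->
  forall n, w n * normc (resolvent_sum a x n.+1) <=
    n.+1%:R * (normc a / (1 - complex.Re a) * M).
Proof.
move=> a1 w0 wn xM; set d := 1 - complex.Re a; set L := _ / d * M.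
have d0 : 0 < d by rewrite subr_gt0.
have dL : d * L = normc a * M by rewrite /L; field; lra.
have step n : w n * normc (resolvent_sum a x n) <= n%:R * L ->
    w n * normc (resolvent_sum a x n.+1) <= n.+1%:R * L.
  move=> IH /=; rewrite !normcM normcV normc_nat mulrA.
  have nd : 0 < n%:R + d by rewrite ltr_wpDl.
  have ge := normc_natB_ge a n.
  rewrite ler_pdivrMr ?(lt_le_trans nd)// mulrCA -mulrA ler_wpM2l//.
  have L0 : 0 <= L.
    rewrite mulr_ge0 ?divr_ge0 ?normc_ge0 ?(ltW d0)//.
    by apply: le_trans (xM 0%N); rewrite mulr_ge0 ?normc_ge0.
  apply: le_trans (_ : L * (n%:R + d) <= _); last by rewrite ler_wpM2l.
  rewrite mulrDr [L * d]mulrC dL [L * _]mulrC.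
  apply: le_trans
    (_ : w n * (normc (resolvent_sum a x n) + normc (a * x n)) <= _).
    by rewrite ler_wpM2l// le_normcD.
  by rewrite mulrDr lerD// normcM mulrCA ler_wpM2l ?normc_ge0.
suff H n : w n * normc (resolvent_sum a x n) <= n%:R * L.
  by move=> n; exact: step.
elim: n => [|n IH]; first by rewrite normcr0 mulr0 mul0r.
by apply: le_trans (step n IH); rewrite ler_wpM2r ?normc_ge0.
Qed.

Lemma resolvent_seq_bound {R : realType} (a : R[i]) (x : nat -> R[i])
    (w : nat -> R) (M : R) :
  complex.Re a < 1 ->
  (forall n, 0 <= w n) -> (forall n, w n.+1 <= w n) ->
  (forall n, w n * normc (x n) <= M) ->
  forall n, w n * normc (resolvent_seq a x n) <=
    normc a * (1 + normc a / (1 - complex.Re a)) * M.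
Proof.
move=> a1 w0 wn xM n; rewrite normcM mulrCA -mulrA ler_wpM2l ?normc_ge0//.
apply: le_trans (ler_wpM2l (w0 n) (le_normcD _ _)) _.
rewrite mulrDr mulrDl mul1r lerD// normcM normcV normc_nat mulrA.
by rewrite ler_pdivrMr// [leRHS]mulrC; exact: resolvent_sum_bound.
Qed.

(** The weight of index [k] is the weight of index [k + 1] times
[exp (- c alpha_n)] for some [c > 0], a factor that tends to 0. *)
Lemma bounded_lambda0 {R : realType} (alpha : nat -> R) (x : nat -> R[i]) :
  increases_to_infty alpha ->
  (forall k, exists M, forall n, weight alpha k n * normc (x n) <= M) ->
  x \in lambda0_pred alpha.
Proof.
move=> [_ _ alphaoo] xB; apply/lambda0_predP => k.
have [M xM] := xB k.+1.
pose c : R := k.+1%:R^-1 - k.+2%:R^-1.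
have c0 : 0 < c by rewrite subr_gt0 ltf_pV2 ?posrE// ltr_nat.
have weightE n :
    weight alpha k n = expR (- (c * alpha n)) * weight alpha k.+1 n.
  by rewrite /weight -expRD; congr expR; rewrite /c; ring.
have lim0 : expR (- (c * alpha n)) * M @[n --> \oo] --> (0 : R).
  rewrite -[X in _ --> X](mul0r M); apply: cvgMl.
  have expoo : expR (- (c * r)) @[r --> +oo] --> (0 : R).
    apply: (cvg_comp _ _ _ (@cvgr_expR R)).
    by apply: gt0_cvgMry => //; exact: cvg_id.
  exact: (cvg_comp _ _ alphaoo expoo).
apply: (squeeze_cvgr _ (cvg_cst (0 : R)) lim0).
apply: nearW => n; rewrite weightM_ge0 /= weightE -mulrA.
by rewrite ler_wpM2l ?expR_ge0.
Qed.

Lemma lambda0_bounded_continuous {R : realType} (alpha : nat -> R)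
    (f : {linear lambda0 alpha -> lambda0 alpha}) (B : R) :
  (forall k x, lambda0_norm k (f x) <= B * lambda0_norm k x) -> continuous f.
Proof.
move=> fB x A [k [e e0 eA]]; pose N := `|B| + 1.
have N0 : 0 < N by rewrite ltr_wpDl.
exists k, (e / N); first by rewrite divr_gt0.
move=> y xy; apply: eA => j jk; rewrite -linearB.
apply: le_lt_trans (fB _ _) _.
apply: le_lt_trans (_ : _ <= N * lambda0_norm j (y - x)) _.
  rewrite ler_wpM2r ?lambda0_norm_ge0//.
  by apply: le_trans (ler_norm B) _; rewrite lerDl.
by rewrite mulrC -ltr_pdivlMr// xy.
Qed.

Theorem mainTheorem7 (R : realType) (alpha : nat -> R)
    (alpha_up : increases_to_infty alpha) :
  spectrum (cesaro_op alpha_up) `<=` [set l : R[i] | `|l - 1 / 2| <= 1 / 2].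
Proof.
move=> l; apply: contra_notP => /outside_disc[l0 a1].
pose a := l^-1; pose B := normc a * (1 + normc a / (1 - complex.Re a)).
have w0 k n : 0 <= weight alpha k n by exact/ltW/weight_gt0.
have wn k n : weight alpha k n.+1 <= weight alpha k n by exact: weight_le.
have yB (x : lambda0 alpha) k n :
    weight alpha k n * normc (resolvent_seq a x n) <= B * lambda0_norm k x.
  by apply: resolvent_seq_bound => // m; exact: lambda0_norm_ub.
have yP (x : lambda0 alpha) : resolvent_seq a x \in lambda0_pred alpha.
  by apply: bounded_lambda0 => // k; exists (B * lambda0_norm k x).
pose S x : lambda0 alpha := Lambda0 (yP x).
pose T : {linear lambda0 alpha -> lambda0 alpha} := cesaro_op alpha_up.
pose lT x : lambda0 alpha := l *: x - T x.
have lTlin : linear lT.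
  move=> b x y; rewrite /lT (linearP T) scalerDr scalerBr !scalerA [l * b]mulrC.
  by rewrite opprD addrACA.
have lTK : cancel lT S.
  move=> x; apply/val_inj/funext => n.
  rewrite -[LHS]/(resolvent_seq l^-1 (fun n => l * x n - cesaro_seq x n) n).
  rewrite /resolvent_seq resolvent_sum_cesaro// -/(cesaro_seq x n) subrK.
  by rewrite mulrA mulVf// mul1r.
have SK : cancel S lT.
  move=> x; apply/val_inj/funext => n.
  rewrite -[LHS]/(l * resolvent_seq l^-1 x n -
    cesaro_seq (resolvent_seq l^-1 x) n).
  rewrite /cesaro_seq sum_resolvent_seq// /resolvent_seq.
  by rewrite mulrA mulfV// mul1r addrK.
(* The inverse of a linear bijection is linear. *)
have Slin : linear S.
  by move=> b x y; rewrite -{1}(SK x) -{1}(SK y) -lTlin lTK.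
pose SL : {linear lambda0 alpha -> lambda0 alpha} :=
  HB.pack S (GRing.isLinear.Build _ _ _ _ S Slin).
have Scont : continuous SL.
  apply: (@lambda0_bounded_continuous _ _ _ B) => k x.
  by apply: lambda0_norm_le => n; exact: yB.
by exists (ContinuousEndo Scont); split.
Qed.
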